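(* Let $A$ be a free group of finite rank $n$ and let $T$ be its Cayley graph with respect to a free basis. Let $B$ be a group, $\varphi:A\to\mathrm{Aut}(B)$ a homomorphism, and suppose $G=B\rtimes_\varphi A$ is finitely generated. Let $\rho$ be the action of $G$ on $T$ induced by the projection $G\twoheadrightarrow A$ and the natural action of $A$ on $T$. If $\varphi(A)\le\mathrm{Aut}(B)$ is abelian and $n\ge2$, then $\Sigma^1(\rho)$ is nonempty.
   Context: **Conventions.** Multiplication in $G=B\rtimes_\varphi A$ is $(b_1,a_1)(b_2,a_2)=(b_1\varphi_{a_1}(b_2),a_1a_2)$. $T$ is a simplicial tree with edges of length 1 and vertex set $A$, and $A$ acts on it by left multiplication. **Rays and horoballs.** Points of $\partial T$ are represented uniquely by geodesic rays $\tau:[0,\infty)\to T$ with $\tau(0)=1\in A$; $\tau(\infty)$ denotes the point represented by $\tau$. For real $t$, $HB_t(\tau)=\bigcup_{l\ge\max\{0,t\}}\overline{\mathrm{Ball}_{l-t}(T,\tau(l))}$ (nested union of closed metric balls of radius $l-t$ centred at $\tau(l)$). **$\Sigma^1(\rho)$.** For an isometric action $\rho$ of $G$ on a proper CAT(0) space $M$ (here $M=T$), choose a non-empty free contractible $G$-CW-complex $Y$ and a continuous $G$-map $h:Y\to M$. For a geodesic ray $\tau$ and $t\in\mathbb{R}$ let $Y_{(\tau,t)}$ be the largest subcomplex of $Y$ contained in $h^{-1}(HB_t(\tau))$. Then $h$ is controlled connected over $\tau(\infty)$ if for every cocompact $G$-subspace $L\subseteq Y$ there is a cocompact $G$-subspace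 $L'\supseteq L$ such that for all $t\in\mathbb{R}$ there exists $\lambda(t)\ge0$ with: $( * )$ any two points of $Y_{(\tau,t)}\cap L$ can be connected by a path in $Y_{(\tau,t-\lambda(t))}\cap L'$; and $( ** )$ any two points of $Y_{(\tau,t+\lambda(t))}\cap L$ can be connected by a path in $Y_{(\tau,t)}\cap L'$. By a theorem of Bieri and Geoghegan this does not depend on the choice of $Y$ and $h$, and $\Sigma^1(\rho)$ is the set of $e\in\partial M$ over which $\rho$ is controlled connected. *)

(* Defs.v *)
From HB Require Import structures.
From mathcomp Require Import all_boot all_order all_algebra all_fingroup.
From mathcomp Require Import all_classical all_reals all_analysis.
From mathcomp Require Import ring.

Set Implicit Arguments.
Unset Strict Implicit.
Unset Printing Implicit Defensive.

Import Order.TTheory GRing.Theory Num.Theory.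
Import numFieldNormedType.Exports.

Local Open Scope classical_set_scope.
Local Open Scope ring_scope.

Definition finitely_generated (G : groupType) : Prop :=
  exists s : seq G, forall H : {pred G},
    group_closed H -> {subset s <= H} -> forall g, g \in H.

(* The letter (i, true) stands for x i and (i, false) for (x i)^-1. *)
Definition letter_val (A : groupType) n (x : 'I_n -> A) (l : 'I_n * bool) : A :=
  if l.2 then x l.1 else ((x l.1)^-1)%g.

Definition word_val (A : groupType) n (x : 'I_n -> A) (w : seq ('I_n * bool)) : A :=
  (\prod_(l <- w) letter_val x l)%g.

Definition reduced n (w : seq ('I_n * bool)) : bool :=
  sorted [rel l l' | l' != (l.1, ~~ l.2)] w.

Record free_basis (A : groupType) (n : nat) := FreeBasis {
  basis_elt :> 'I_n -> A ;
  free_basisP : forall a, exists! w, reduced w /\ word_val basis_elt w = a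
}.

Section Automorphisms.
Variable B : groupType.

Record Autom := MkAutom {
  aut_fun :> B -> B ;
  aut_inv_fun : B -> B ;
  autM : {morph aut_fun : x y / (x * y)%g} ;
  autK : cancel aut_fun aut_inv_fun ;
  autVK : cancel aut_inv_fun aut_fun
}.

Lemma Autom_eq (f g : Autom) : aut_fun f =1 aut_fun g -> f = g.
Proof.
case: f g => [f f' fM fK f'K] [g g' gM gK g'K] /= fg.
have {}fg : f = g by exact/funext.
move: fM fK f'K; rewrite fg => fM fK f'K.
have fg' : f' = g' by apply/funext => y; rewrite -{1}(g'K y) fK.
move: fK f'K; rewrite fg' => fK f'K.
by congr MkAutom; exact: Prop_irrelevance.
Qed.

Definition aut_one : Autom := @MkAutom idfun idfun (fun _ _ => erefl) (frefl _) (frefl _).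

Program Definition aut_mul (f g : Autom) : Autom :=
  @MkAutom (f \o g) (aut_inv_fun g \o aut_inv_fun f) _
    (can_comp (@autK f) (@autK g)) (can_comp (@autVK g) (@autVK f)).
Next Obligation. by move=> f g x y /=; rewrite !autM. Qed.

Program Definition aut_inv (f : Autom) : Autom :=
  @MkAutom (aut_inv_fun f) f _ (@autVK f) (@autK f).
Next Obligation.
move=> f x y; apply: (can_inj (@autK f)).
by rewrite autM !autVK.
Qed.

HB.instance Definition _ := gen_eqMixin Autom.
HB.instance Definition _ := gen_choiceMixin Autom.

Fact aut_mulA : associative aut_mul. Proof. by move=> f g h; exact: Autom_eq. Qed.
Fact aut_mul1 : left_id aut_one aut_mul. Proof. by move=> f; exact: Autom_eq. Qed.
Fact aut_1mul : right_id aut_one aut_mul. Proof. by move=> f; exact: Autom_eq. Qed.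
Fact aut_mulV : left_inverse aut_one aut_inv aut_mul.
Proof. by move=> f; apply: Autom_eq => x /=; rewrite autK. Qed.
Fact aut_Vmul : right_inverse aut_one aut_inv aut_mul.
Proof. by move=> f; apply: Autom_eq => x /=; rewrite autVK. Qed.

HB.instance Definition _ :=
  isGroup.Build Autom aut_mulA aut_mul1 aut_1mul aut_mulV aut_Vmul.

End Automorphisms.

(* The argument phi only serves to attach the group law to the type. *)
Definition semidirect (A B : groupType) (phi : {multiplicative A -> Autom B}) : Type :=
  (B * A)%type.

Section SemidirectProduct.
Variables (A B : groupType) (phi : {multiplicative A -> Autom B}).
Local Notation semidirect := (semidirect phi).

HB.instance Definition _ := Choice.copy semidirect (B * A)%type.

Definition semidirect_one : semidirect := (1%g, 1%g).
Definition semidirect_mul (g h : semidirect) : semidirect :=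
  ((g.1 * phi g.2 h.1)%g, (g.2 * h.2)%g).
Definition semidirect_inv (g : semidirect) : semidirect :=
  (phi (g.2^-1)%g (g.1^-1)%g, (g.2^-1)%g).

Let phi1 b : phi 1%g b = b.
Proof.
have : (phi 1 * phi 1 = phi 1)%g by rewrite -gmulfM mulg1.
by move/(congr1 (fun f : Autom B => (phi 1 : Autom B)^-1 * f)%g); rewrite mulKg mulVg => ->.
Qed.

Let phiM a a' b : phi (a * a')%g b = phi a (phi a' b).
Proof. by rewrite gmulfM. Qed.

Let phi_1 a : phi a 1%g = 1%g.
Proof.
have : (phi a 1 * phi a 1 = phi a 1)%g by rewrite -autM mulg1.
by move/(congr1 (mul (phi a 1)^-1%g)); rewrite mulKg mulVg.
Qed.

Fact semidirect_mulA : associative semidirect_mul.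
Proof.
by move=> [b a] [b' a'] [b2 a2]; rewrite /semidirect_mul /= autM phiM !mulgA.
Qed.
Fact semidirect_mul1 : left_id semidirect_one semidirect_mul.
Proof. by move=> [b a]; rewrite /semidirect_mul /= phi1 !mul1g. Qed.
Fact semidirect_1mul : right_id semidirect_one semidirect_mul.
Proof. by move=> [b a]; rewrite /semidirect_mul /= phi_1 !mulg1. Qed.
Fact semidirect_mulV : left_inverse semidirect_one semidirect_inv semidirect_mul.
Proof.
by move=> [b a]; rewrite /semidirect_mul /= -autM !mulVg phi_1.
Qed.
Fact semidirect_Vmul : right_inverse semidirect_one semidirect_inv semidirect_mul.
Proof.
by move=> [b a]; rewrite /semidirect_mul /= -phiM !mulgV phi1 mulgV.
Qed.

HB.instance Definition _ := isGroup.Build semidirect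
  semidirect_mulA semidirect_mul1 semidirect_1mul semidirect_mulV semidirect_Vmul.

End SemidirectProduct.

Definition group_action (G : groupType) (Y : Type) (act : G -> Y -> Y) : Prop :=
  (forall y, act 1%g y = y) /\ (forall g h y, act (g * h)%g y = act g (act h y)).

Record isometric_action (R : realType) (G : groupType) (M : metricType R) :=
  IsometricAction {
    iact :> G -> M -> M ;
    iact_action : group_action iact ;
    iact_isom : forall g p q, mdist (iact g p) (iact g q) = mdist p q
  }.

(* Geometric realization of the Cayley graph: points are given by their
   barycentric coordinates, i.e. finitely supported functions on A, and the edge
   from a to a * X i is parametrized by [0, 1]. A free basis yields neither
   loops nor multiple edges, so this is faithful. *)
Section CayleyTree.
Variables (R : realType) (A : groupType) (n : nat) (X : free_basis A n).

Definition vertex_coord (a : A) : A -> R := fun c => (c == a)%:R.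

Definition edge_coord (a : A) (i : 'I_n) (s : R) : A -> R :=
  fun c => (1 - s) * vertex_coord a c + s * vertex_coord (a * X i)%g c.

Record cayley_tree := CayleyTree {
  bary : A -> R ;
  baryP : (exists a, bary = vertex_coord a) \/
          (exists a i s, 0 <= s <= 1 /\ bary = edge_coord a i s)
}.

Lemma bary_inj : injective bary.
Proof.
case=> [f fP] [g gP] /= fg; move: fP gP; rewrite fg => fP gP.
by congr CayleyTree; exact: Prop_irrelevance.
Qed.

HB.instance Definition _ := gen_eqMixin cayley_tree.
HB.instance Definition _ := gen_choiceMixin cayley_tree.

Definition vertex (a : A) : cayley_tree :=
  CayleyTree (or_introl (ex_intro _ a erefl)).

(* [broken_line p q l]: there are points p = p_0, p_1, .., p_k = q such that
   p_j and p_j+1 lie on a common edge, of total length l. *)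
Inductive broken_line : cayley_tree -> cayley_tree -> R -> Prop :=
| BrokenNil p : broken_line p p 0
| BrokenCons a i s t p q r l :
    0 <= s <= 1 -> bary p = edge_coord a i s ->
    0 <= t <= 1 -> bary q = edge_coord a i t ->
    broken_line q r l -> broken_line p r (`|s - t| + l).

Definition tree_dist (p q : cayley_tree) : R := inf [set l | broken_line p q l].

Lemma broken_line_ge0 p q l : broken_line p q l -> 0 <= l.
Proof. by elim=> // *; rewrite addr_ge0. Qed.

Lemma broken_line_cat p q r l l' :
  broken_line p q l -> broken_line q r l' -> broken_line p r (l + l').
Proof.
move=> pq; elim: pq r l' => [p0|a i s t p0 q0 r0 l0 s01 ps t01 qt _ IH] r1 l' H.
  by rewrite add0r.
by rewrite -addrA; apply: (BrokenCons s01 ps t01 qt); exact: IH.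
Qed.

Lemma broken_line_rev p q l : broken_line p q l -> broken_line q p l.
Proof.
elim=> [p0|a i s t p0 q0 r0 l0 s01 ps t01 qt _ IH]; first exact: BrokenNil.
rewrite addrC; apply: broken_line_cat IH _.
by rewrite -[X in broken_line _ _ X]addr0 distrC;
  apply: (BrokenCons t01 qt s01 ps); exact: BrokenNil.
Qed.

Lemma broken_line_coord p q l c : broken_line p q l -> `|bary p c - bary q c| <= l.
Proof.
elim=> [p0|a i s t p0 q0 r0 l0 s01 ps t01 qt _ IH]; first by rewrite subrr normr0.
rewrite -(subrKA (bary q0 c)) (le_trans (ler_normD _ _))// lerD// ps qt.
have -> : edge_coord a i s c - edge_coord a i t c =
    (s - t) * (vertex_coord (a * X i)%g c - vertex_coord a c).
  by rewrite /edge_coord; ring.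
rewrite normrM ler_piMr// /vertex_coord.
by do 2!case: (c == _); rewrite ?subrr ?subr0 ?sub0r ?normrN ?normr0 ?normr1.
Qed.

Lemma edge_coord0 a i : edge_coord a i 0 = vertex_coord a.
Proof. by apply/funext => c; rewrite /edge_coord subr0 mul1r mul0r addr0. Qed.

Lemma edge_coord1 a i : edge_coord a i 1 = vertex_coord (a * X i)%g.
Proof. by apply/funext => c; rewrite /edge_coord subrr mul1r mul0r add0r. Qed.

Lemma broken_line_edge a i : exists l, broken_line (vertex a) (vertex (a * X i)%g) l.
Proof.
exists (`|0 - 1| + 0); apply: (@BrokenCons a i) (BrokenNil _).
- by rewrite lexx ler01.
- by rewrite edge_coord0.
- by rewrite lexx ler01.
- by rewrite edge_coord1.
Qed.

Lemma broken_line_word (w : seq ('I_n * bool)) (a : A) :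
  exists l, broken_line (vertex a) (vertex (a * word_val X w)%g) l.
Proof.
elim: w a => [|[i b] w IH] a.
  by rewrite /word_val big_nil mulg1; exists 0; exact: BrokenNil.
rewrite /word_val big_cons mulgA.
have [l1 H1] := IH (a * letter_val X (i, b))%g.
suff [l2 H2] : exists l, broken_line (vertex a) (vertex (a * letter_val X (i, b))%g) l.
  by exists (l2 + l1); exact: broken_line_cat H2 H1.
case: b {H1}; first exact: broken_line_edge.
have [l H] := broken_line_edge (a * (X i)^-1)%g i.
by exists l; apply: broken_line_rev; rewrite mulgVK in H.
Qed.

Lemma broken_line_to1 p : exists l, broken_line p (vertex 1%g) l.
Proof.
suff [a [l H]] : exists a l, broken_line p (vertex a) l.
  have [w [[_ wa] _]] := free_basisP X (a^-1)%g.
  have [l' H'] := broken_line_word w a.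
  by exists (l + l'); apply: broken_line_cat H _; rewrite wa mulgV in H'.
have [[a pa]|[a [i [s [s01 ps]]]]] := baryP p.
  exists a, 0; suff -> : p = vertex a by exact: BrokenNil.
  exact: bary_inj.
exists a, (`|s - 0| + 0); apply: (@BrokenCons a i s 0) s01 ps _ _ (BrokenNil _).
- by rewrite lexx ler01.
- by rewrite edge_coord0.
Qed.

Lemma broken_line_has_inf p q : has_inf [set l | broken_line p q l].
Proof.
split; last by exists 0 => l /broken_line_ge0.
have [l H] := broken_line_to1 p; have [l' H'] := broken_line_to1 q.
by exists (l + l'); apply: broken_line_cat H (broken_line_rev H').
Qed.

Lemma tree_dist_le p q l : broken_line p q l -> tree_dist p q <= l.
Proof. by move=> H; apply: ge_inf => //; case: (broken_line_has_inf p q). Qed.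

Lemma tree_dist_ge0 p q : 0 <= tree_dist p q.
Proof.
apply: lb_le_inf; first by case: (broken_line_has_inf p q).
by move=> l /broken_line_ge0.
Qed.

Lemma tree_distxx p : tree_dist p p = 0.
Proof.
by apply/eqP; rewrite eq_le tree_dist_ge0 andbT; apply/tree_dist_le/BrokenNil.
Qed.

Lemma tree_dist_positivity p q : tree_dist p q = 0 -> p = q.
Proof.
move=> pq0; apply: bary_inj; apply/funext => c; apply/eqP.
rewrite -subr_eq0 -normr_le0 -pq0.
apply: lb_le_inf; first by case: (broken_line_has_inf p q).
by move=> l; exact: broken_line_coord.
Qed.

Lemma tree_dist_sym p q : tree_dist p q = tree_dist q p.
Proof.
by congr inf; apply/seteqP; split => l; exact: broken_line_rev.
Qed.

Lemma tree_dist_triangle q p r : tree_dist p r <= tree_dist p q + tree_dist q r.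
Proof.
rewrite -lerBlDr; apply: lb_le_inf; first by case: (broken_line_has_inf p q).
move=> l pq; rewrite lerBlDr -lerBlDl.
apply: lb_le_inf; first by case: (broken_line_has_inf q r).
by move=> l' qr; rewrite lerBlDl; apply/tree_dist_le/(broken_line_cat pq).
Qed.

HB.instance Definition _ := isMetric.Build R cayley_tree
  tree_distxx tree_dist_positivity tree_dist_sym tree_dist_triangle.

Lemma vertex_coord_trans a b c :
  vertex_coord b (a^-1 * c)%g = vertex_coord (a * b)%g c.
Proof.
rewrite /vertex_coord; congr (_%:R); congr nat_of_bool.
by rewrite -(inj_eq (mulgI a)) mulVKg.
Qed.

Lemma edge_coord_trans a b i s c :
  edge_coord b i s (a^-1 * c)%g = edge_coord (a * b)%g i s c.
Proof. by rewrite /edge_coord !vertex_coord_trans mulgA. Qed.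

Program Definition tree_act (a : A) (p : cayley_tree) : cayley_tree :=
  @CayleyTree (fun c => bary p (a^-1 * c)%g) _.
Next Obligation.
move=> a p; have [[b pb]|[b [i [s [s01 ps]]]]] := baryP p; [left|right].
  by exists (a * b)%g; apply/funext => c; rewrite pb vertex_coord_trans.
exists (a * b)%g, i, s; split => //.
by apply/funext => c; rewrite ps edge_coord_trans.
Qed.

Lemma tree_act_action : group_action tree_act.
Proof.
split=> [p|a b p]; apply: bary_inj; apply/funext => c /=.
  by rewrite invg1 mul1g.
by rewrite invgM mulgA.
Qed.

Lemma broken_line_act a p q l :
  broken_line p q l -> broken_line (tree_act a p) (tree_act a q) l.
Proof.
elim=> [p0|b i s t p0 q0 r0 l0 s01 ps t01 qt _ IH]; first exact: BrokenNil.
apply: (@BrokenCons (a * b)%g i s t) s01 _ t01 _ IH; apply/funext => c /=.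
  by rewrite ps edge_coord_trans.
by rewrite qt edge_coord_trans.
Qed.

Lemma tree_act_isom a p q :
  mdist (tree_act a p) (tree_act a q) = mdist p q.
Proof.
congr inf; apply/seteqP; split => l; last exact: broken_line_act.
move/(broken_line_act a^-1%g).
by rewrite -!(proj2 tree_act_action) mulVg !(proj1 tree_act_action).
Qed.

End CayleyTree.

Arguments vertex R {A n} X a.
Arguments cayley_tree R {A n} X.

Program Definition induced_action (R : realType) (A B : groupType) (n : nat)
    (X : free_basis A n) (phi : {multiplicative A -> Autom B}) :
    isometric_action (semidirect phi) (cayley_tree R X) :=
  @IsometricAction R _ _ (fun g p => tree_act g.2 p) _ _.
Next Obligation.
move=> R A B n X phi; have [act1 actM] := @tree_act_action R A n X.
by split => [y|g h y] /=; [exact: act1|exact: actM].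
Qed.
Next Obligation. by move=> R A B n X phi g p q; exact: tree_act_isom. Qed.

Section CWComplexes.
Variable R : realType.

Definition disk d : set 'rV[R]_d := [set v | \sum_i v ord0 i ^+ 2 <= 1].
Definition open_disk d : set 'rV[R]_d := [set v | \sum_i v ord0 i ^+ 2 < 1].
Definition sphere d : set 'rV[R]_d := [set v | \sum_i v ord0 i ^+ 2 = 1].
Arguments disk d : clear implicits.
Arguments open_disk d : clear implicits.
Arguments sphere d : clear implicits.

(* Only the restriction of [chi e] to the closed disk is meaningful. As Y is
   Hausdorff, [chi_inj], [cell_partition] and [closure_finite] make [chi e] a
   homeomorphism from the open disk onto the open cell. *)
Record cw_structure (Y : topologicalType) := CWStructure {
  cell : Type ;
  cell_dim : cell -> nat ;
  chi : forall e : cell, 'rV[R]_(cell_dim e) -> Y ;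
  cw_hausdorff : hausdorff_space Y ;
  chi_continuous : forall e, {within disk (cell_dim e), continuous (@chi e)} ;
  chi_inj : forall e, set_inj (open_disk (cell_dim e)) (@chi e) ;
  cell_partition : forall y, exists! e, (@chi e @` open_disk (cell_dim e)) y ;
  closure_finite : forall e, exists F : set cell,
    [/\ finite_set F, (forall f, F f -> (cell_dim f < cell_dim e)%N) &
        @chi e @` sphere (cell_dim e) `<=`
          \bigcup_(f in F) (@chi f @` open_disk (cell_dim f))] ;
  cw_weak : forall C : set Y,
    closed C <-> forall e, closed (disk (cell_dim e) `&` @chi e @^-1` C)
}.

Arguments chi {Y} {_} e.

Section Cells.
Variables (Y : topologicalType) (K : cw_structure Y).

Definition open_cell (e : cell K) : set Y := chi e @` open_disk (cell_dim e).
Definition closed_cell (e : cell K) : set Y := chi e @` disk (cell_dim e).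

(* As the open cells cover Y, such an S is the union of the open cells which it
   meets, together with their closures. *)
Definition subcomplex (S : set Y) : Prop :=
  forall e, open_cell e `&` S !=set0 -> closed_cell e `<=` S.

(* A union of subcomplexes is a subcomplex. *)
Definition largest_subcomplex_in (S : set Y) : set Y :=
  \bigcup_(S' in [set S' | subcomplex S' /\ S' `<=` S]) S'.

End Cells.

Record gcw_complex (G : groupType) := GCWComplex {
  gcw_space :> topologicalType ;
  gcw_cells : cw_structure gcw_space ;
  gcw_act : G -> gcw_space -> gcw_space ;
  gcw_act_action : group_action gcw_act ;
  gcw_act_continuous : forall g, continuous (gcw_act g) ;
  gcw_act_cell : forall g (e : cell gcw_cells), exists e' : cell gcw_cells,
    cell_dim e' = cell_dim e /\ gcw_act g @` open_cell e = open_cell e' ;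
  gcw_act_rigid : forall g (e : cell gcw_cells),
    gcw_act g @` open_cell e = open_cell e ->
    forall y, open_cell e y -> gcw_act g y = y
}.

Definition free_gcw (G : groupType) (Y : gcw_complex G) : Prop :=
  forall g (y : Y), gcw_act g y = y -> g = 1%g.

Definition contractible (Y : topologicalType) : Prop :=
  exists (y0 : Y) (H : Y * R -> Y),
    [/\ {within setT `*` `[0, 1], continuous H},
        forall y, H (y, 0) = y & forall y, H (y, 1) = y0].

Definition connected_by_path (Y : topologicalType) (S : set Y) (y z : Y) : Prop :=
  exists c : R -> Y, [/\ {within `[0, 1], continuous c},
    c 0 = y, c 1 = z & forall s, 0 <= s <= 1 -> S (c s)].

Definition invariant_subset (G : groupType) (Y : gcw_complex G) (L : set Y) : Prop :=
  forall g y, L y -> L (gcw_act g y).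

(* The open subsets of the orbit space Y/G are the images of the invariant open
   subsets of Y, and L/G carries both the quotient topology and the topology
   induced from Y/G; the condition below is the compactness of L/G. *)
Definition cocompact_subspace (G : groupType) (Y : gcw_complex G) (L : set Y) :
    Prop :=
  invariant_subset L /\
  forall U : set (set Y),
    (forall V, U V -> open V /\ invariant_subset V) -> L `<=` \bigcup_(V in U) V ->
    exists2 U', finite_set U' /\ U' `<=` U & L `<=` \bigcup_(V in U') V.

End CWComplexes.
Arguments disk R d : clear implicits.
Arguments open_disk R d : clear implicits.
Arguments sphere R d : clear implicits.

Section Sigma.
Variables (R : realType) (M : metricType R).

Record geodesic_ray (o : M) := GeodesicRay {
  ray_fun :> {nonneg R} -> M ;
  ray_origin : ray_fun 0%:nng = o ;
  ray_geodesic : forall s t, mdist (ray_fun s) (ray_fun t) = `|s%:num - t%:num|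
}.

(* HB_t(tau); the condition 0 <= l is part of the type of l. *)
Definition horoball (o : M) (tau : geodesic_ray o) (t : R) : set M :=
  \bigcup_(l in [set l : {nonneg R} | t <= l%:num])
    [set p | mdist (tau l) p <= l%:num - t].

Variables (G : groupType) (rho : isometric_action G M) (o : M).

Definition equivariant (Y : gcw_complex R G) (h : Y -> M) : Prop :=
  forall g y, h (gcw_act g y) = rho g (h y).

Definition horoball_subcomplex (Y : gcw_complex R G) (h : Y -> M)
    (tau : geodesic_ray o) (t : R) : set Y :=
  largest_subcomplex_in (gcw_cells Y) (h @^-1` horoball tau t).

Definition controlled_connected (Y : gcw_complex R G) (h : Y -> M)
    (tau : geodesic_ray o) : Prop :=
  forall L : set Y, cocompact_subspace L ->
  exists L' : set Y, [/\ cocompact_subspace L', L `<=` L' &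
    forall t : R, exists lambda : R, [/\ 0 <= lambda,
      forall y z, (horoball_subcomplex h tau t `&` L) y ->
        (horoball_subcomplex h tau t `&` L) z ->
        connected_by_path R (horoball_subcomplex h tau (t - lambda) `&` L') y z &
      forall y z, (horoball_subcomplex h tau (t + lambda) `&` L) y ->
        (horoball_subcomplex h tau (t + lambda) `&` L) z ->
        connected_by_path R (horoball_subcomplex h tau t `&` L') y z]].

(* The boundary of a proper CAT(0) space is identified with the set of geodesic
   rays issuing from the base point o. Controlled connectivity does not depend
   on Y and h, so every choice of them is required to satisfy it. *)
Definition Sigma1 : set (geodesic_ray o) :=
  [set tau | forall (Y : gcw_complex R G) (h : Y -> M),
    free_gcw Y -> contractible R Y -> continuous h -> equivariant h ->
    controlled_connected h tau].

End Sigma.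
Arguments Sigma1 {R M G} rho o.

(* Main.v *)
Require Import Defs.
From HB Require Import structures.
From mathcomp Require Import all_boot all_order all_algebra.
From mathcomp Require Import all_classical all_reals all_analysis.
From mathcomp Require Import ring lra.
From Stdlib Require Import Relation_Operators.

(** Write [x], [y] for two basis elements. The ray runs from the vertex 1 along
    the infinite reduced word [x y x^-1 y^-1 x y x^-1 y^-1 ...], so it passes
    through the vertices [v_(4k) = (x y x^-1 y^-1)^k]. As the image of [phi] is abelian,
    [phi v_(4k) = 1]. Hence for every vertex [c] the vertex [v_(4k) c] acts on [B]
    as [c] does, and it lies in any prescribed horoball once [k] is large, because
    it stays at bounded distance from [v_(4k)]: every horoball contains vertices
    realizing all of [phi(A)] ([horoball_lift]).

    In the semidirect product, use the generators [(1, x_i)], and [(b, 1)] for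
    [b] in the finite set of [B]-components of given generators. Over a vertex [a]
    the generator [(b, 1)] right multiplies the [B]-coordinate by [phi a b].
    Two elements of [G] lying over the same horoball are then joined by a chain
    over that horoball: the [A]-coordinate can be moved freely, since a horoball
    is a subtree ([chain_horoball]), in particular to a vertex acting on [B] as
    any chosen [c] does, so the [B]-coordinate can be multiplied by every
    [phi c b], and these elements generate [B] ([chain_fibre]).

    For an arbitrary free contractible complex [Y] over the tree, a cocompact
    subspace is covered by the translates of a compact subcomplex
    ([cocompact_sub_translates]). A contraction of [Y] to a point [y0] moves this
    subcomplex and the points [s y0], [s] a generator, through a compact set; the
    translates of this set have images of bounded diameter in the tree. Therefore a chain
    in [G] over a horoball gives a path in [Y] over a slightly larger horoball,
    inside one fixed cocompact subspace; the loss is the same for every horoball,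
    so [lambda] can even be chosen independently of [t]
    ([controlled_connected_of_chains]). *)

Set Implicit Arguments.
Unset Strict Implicit.
Unset Printing Implicit Defensive.

Import Order.TTheory GRing.Theory Num.Theory.
Import numFieldNormedType.Exports.

Local Open Scope classical_set_scope.
Local Open Scope ring_scope.

(** * Word length in a free group *)

Section WordLength.
Variables (A : groupType) (n : nat) (X : free_basis A n).
Implicit Types (a : A) (l : 'I_n * bool) (w : seq ('I_n * bool)).

Lemma word_val_rcons w l :
  word_val X (rcons w l) = (word_val X w * letter_val X l)%g.
Proof. by rewrite /word_val -cats1 big_cat big_seq1. Qed.

Lemma letter_valV l : letter_val X (l.1, ~~ l.2) = (letter_val X l)^-1%g.
Proof. by case: l => i [] //=; rewrite /letter_val /= invgK. Qed.

Lemma reduced_rcons w l l0 :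
  reduced (rcons (rcons w l0) l) = reduced (rcons w l0) && (l != (l0.1, ~~ l0.2)).
Proof. by case: w => [|a w]; rewrite /reduced /= ?andbT // !rcons_path !last_rcons. Qed.

Lemma reduced_rconsW w l : reduced (rcons w l) -> reduced w.
Proof. by case: w => //= a w; rewrite /reduced /= rcons_path => /andP[]. Qed.

Definition reduced_word a := sval (cid (free_basisP X a)).

Lemma reduced_wordP a :
  reduced (reduced_word a) /\ word_val X (reduced_word a) = a.
Proof. by rewrite /reduced_word; case: cid => w []. Qed.

Lemma reduced_word_val w : reduced w -> reduced_word (word_val X w) = w.
Proof.
move=> rw; rewrite /reduced_word; case: cid => w' [_] /= uniq_w'.
exact: uniq_w'.
Qed.

Definition word_length a := size (reduced_word a).

Lemma word_length_val w : reduced w -> word_length (word_val X w) = size w.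
Proof. by move=> rw; rewrite /word_length reduced_word_val. Qed.

(** Appending a letter to a reduced word either yields a reduced word or
    cancels the last letter. *)
Lemma word_length_letter a l :
  (word_length (a * letter_val X l)%g <= (word_length a).+1)%N.
Proof.
have [] := reduced_wordP a; rewrite {2}/word_length.
case/lastP: (reduced_word a) => [|w l0] rw <-.
  have -> : (word_val X [::] * letter_val X l)%g = word_val X (rcons [::] l).
    by rewrite word_val_rcons.
  by rewrite word_length_val.
have [ll0|ll0] := eqVneq l (l0.1, ~~ l0.2); last first.
  by rewrite -word_val_rcons word_length_val ?size_rcons// reduced_rcons rw.
rewrite ll0 letter_valV word_val_rcons mulgK word_length_val.
  by rewrite size_rcons !leqW.
exact: reduced_rconsW rw.
Qed.

Lemma word_length_edge a i :
  (word_length (a * X i)%g <= (word_length a).+1)%N /\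
  (word_length a <= (word_length (a * X i)%g).+1)%N.
Proof.
split; first exact: (word_length_letter a (i, true)).
by have := word_length_letter (a * X i)%g (i, false); rewrite /letter_val mulgK.
Qed.

Lemma basis_neq1 i : X i != 1%g.
Proof.
apply/eqP => Xi1; have := @word_length_val [:: (i, true)] erefl.
rewrite /word_val big_seq1 /letter_val Xi1.
by have := @word_length_val [::] erefl; rewrite /word_val big_nil => ->.
Qed.

End WordLength.

(** * The metric of the Cayley tree *)

Section TreeMetric.
Variables (R : realType) (A : groupType) (n : nat) (X : free_basis A n).
Local Notation T := (cayley_tree R X).
Implicit Types (a : A) (p q : T).

(** The affine extension of word length to the tree. Broken lines only
    bound distances from above; the Lipschitz property of this function bounds
    them from below. *)
Definition tree_height p : R :=
  \sum_(c \in [set: A]) bary p c * (word_length X c)%:R.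

Lemma tree_height_edge p a i s : bary p = edge_coord X a i s ->
  tree_height p =
  (1 - s) * (word_length X a)%:R + s * (word_length X (a * X i)%g)%:R.
Proof.
move=> pE; have aXi : (a == (a * X i)%g) = false.
  apply/negP => /eqP; rewrite -{1}[a]mulg1 => /mulgI/esym/eqP.
  by rewrite (negbTE (basis_neq1 X i)).
rewrite /tree_height (@fsbigE _ _ _ _ _ [:: a; (a * X i)%g])//=.
- rewrite !big_cons big_nil !in_setT pE /edge_coord /vertex_coord !eqxx.
  by rewrite eq_sym [(_ == a)]eq_sym aXi /=; ring.
- by rewrite inE aXi.
- move=> c _; rewrite !inE negb_or => /andP[/negbTE ca /negbTE cb].
  by rewrite pE /edge_coord /vertex_coord ca cb /=; ring.
Qed.

Lemma tree_height_vertex a : tree_height (vertex R X a) = (word_length X a)%:R.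
Proof.
rewrite /tree_height (@fsbigE _ _ _ _ _ [:: a])//=.
- by rewrite big_cons big_nil in_setT /vertex_coord eqxx mul1r addr0.
- by move=> c _; rewrite inE /= /vertex_coord => /negbTE->; rewrite mul0r.
Qed.

Lemma tree_height_lipschitz p q : `|tree_height p - tree_height q| <= mdist p q.
Proof.
apply: lb_le_inf; first by case: (broken_line_has_inf p q).
move=> l; elim=> [p0|a i s t p0 q0 r0 l0 s01 ps t01 qt _ IH].
  by rewrite subrr normr0.
rewrite -(subrKA (tree_height q0)) (le_trans (ler_normD _ _))// lerD//.
rewrite (tree_height_edge ps) (tree_height_edge qt).
set u := (word_length X a)%:R; set v := (word_length X (a * X i)%g)%:R.
have -> : (1 - s) * u + s * v - ((1 - t) * u + t * v) = (s - t) * (v - u) :> R.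
  by ring.
rewrite normrM ler_piMr// ler_norml /u /v.
have [] := word_length_edge X a i; rewrite -!(ler_nat R) -!natr1 => h1 h2.
by apply/andP; split; lra.
Qed.

Lemma mdist_same_edge p q a i (s t : R) :
  0 <= s <= 1 -> bary p = edge_coord X a i s ->
  0 <= t <= 1 -> bary q = edge_coord X a i t -> mdist p q <= `|s - t|.
Proof.
move=> s01 pE t01 qE; rewrite -[leRHS]addr0; apply: tree_dist_le.
exact: BrokenCons s01 pE t01 qE (BrokenNil _).
Qed.

Lemma mdist_letter a l : mdist (vertex R X a) (vertex R X (a * letter_val X l)%g) <= 1.
Proof.
have edge b i : mdist (vertex R X b) (vertex R X (b * X i)%g) <= 1.
  have := @mdist_same_edge (vertex R X b) (vertex R X (b * X i)%g) b i 0 1.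
  rewrite sub0r normrN normr1 edge_coord0 edge_coord1; apply => //.
    by rewrite lexx ler01.
  by rewrite lexx ler01.
case: l => i []; first exact: edge.
by rewrite metric_sym; have := edge (a * (X i)^-1)%g i; rewrite mulgVK.
Qed.

Lemma mdist_word a w :
  mdist (vertex R X a) (vertex R X (a * word_val X w)%g) <= (size w)%:R.
Proof.
elim/last_ind: w => [|w l IH]; first by rewrite /word_val big_nil mulg1 mdistxx.
rewrite word_val_rcons mulgA size_rcons -natr1.
apply: le_trans (metric_triangle _ (vertex R X (a * word_val X w)%g) _) _.
by rewrite lerD// mdist_letter.
Qed.

Lemma tree_act_vertex a b : tree_act a (vertex R X b) = vertex R X (a * b)%g.
Proof. by apply: bary_inj; apply/funext => c; rewrite /= vertex_coord_trans. Qed.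

Lemma word_length_le_mdist a b :
  (word_length X (a^-1 * b)%g)%:R <= mdist (vertex R X a) (vertex R X b).
Proof.
rewrite -(@tree_act_isom R A n X a^-1%g) !tree_act_vertex mulVg.
apply: le_trans (tree_height_lipschitz _ _).
rewrite !tree_height_vertex -normrN opprB.
have := @word_length_val _ _ X [::] erefl; rewrite /word_val big_nil => ->.
by rewrite subr0 ger0_norm.
Qed.

End TreeMetric.

(** * The geodesic ray of an infinite reduced word *)

Section Ray.
Variables (R : realType) (A : groupType) (n : nat) (X : free_basis A n).
Variable L : nat -> 'I_n * bool.
Hypothesis L_reduced : forall k, L k.+1 != ((L k).1, ~~ (L k).2).
Local Notation T := (cayley_tree R X).

Definition ray_vertex k := word_val X (mkseq L k).

Lemma ray_vertexS k : ray_vertex k.+1 = (ray_vertex k * letter_val X (L k))%g.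
Proof. by rewrite /ray_vertex mkseqS word_val_rcons. Qed.

Lemma word_length_ray_vertex k : word_length X (ray_vertex k) = k.
Proof.
rewrite word_length_val ?size_mkseq //.
by elim: k => // -[//|k]; rewrite !mkseqS reduced_rcons L_reduced => ->.
Qed.

Definition segment_coord k (s : R) : A -> R := fun c =>
  (1 - s) * vertex_coord R (ray_vertex k) c +
  s * vertex_coord R (ray_vertex k.+1) c.

(** The edge between consecutive vertices of the ray is parametrized in the
    Cayley tree either forwards or backwards, according to the sign of the
    letter; [f] is the corresponding change of parameter. *)
Lemma segment_coordE k : exists a i (f : R -> R),
  [/\ forall s, segment_coord k s = edge_coord X a i (f s),
      forall s, 0 <= s <= 1 -> 0 <= f s <= 1 &
      forall s t, `|f s - f t| = `|s - t|].
Proof.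
rewrite /segment_coord ray_vertexS; case: (L k) => i [].
  by exists (ray_vertex k), i, id; split.
exists (ray_vertex k * (X i)^-1)%g, i, (fun s => 1 - s); split.
- by move=> s; apply/funext => c; rewrite /edge_coord /letter_val /= mulgVK; ring.
- by move=> s; lra.
- by move=> s t; rewrite -normrN; congr (`|_|); ring.
Qed.

Lemma segment_coord0 k : segment_coord k 0 = vertex_coord R (ray_vertex k).
Proof. by apply/funext => c; rewrite /segment_coord; ring. Qed.

Lemma segment_coord1 k : segment_coord k 1 = vertex_coord R (ray_vertex k.+1).
Proof. by apply/funext => c; rewrite /segment_coord; ring. Qed.

Definition ray_coord (t : R) : A -> R :=
  segment_coord (Num.truncn t) (t - (Num.truncn t)%:R).

(** Both ends of the segment are included, so that two times on the same closed
    segment can be compared even when their integer parts differ. *)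
Lemma ray_coordE k (t : R) :
  k%:R <= t <= k.+1%:R -> ray_coord t = segment_coord k (t - k%:R).
Proof.
move=> /andP[kt]; rewrite le_eqVlt => /predU1P[->|tk]; last first.
  by rewrite /ray_coord (@truncn_def _ _ k)// kt.
rewrite /ray_coord (@truncn_def _ _ k.+1) ?lexx ?ltr_nat ?leqnn// subrr segment_coord0.
by rewrite -segment_coord1 -natr1; congr (segment_coord _ _); ring.
Qed.

Lemma ray_coord_tree (t : {nonneg R}) :
  (exists a, ray_coord t%:num = vertex_coord R a) \/
  (exists a i s, 0 <= s <= 1 /\ ray_coord t%:num = edge_coord X a i s).
Proof.
right; have [a [i [f [fE f01 _]]]] := segment_coordE (Num.truncn t%:num).
exists a, i, (f (t%:num - (Num.truncn t%:num)%:R)); split; last exact: fE.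
have t0 : 0 <= t%:num by [].
have /andP[kt tk] := truncn_itv t0.
by apply: f01; rewrite subr_ge0 kt lerBlDl natr1 ltW.
Qed.

Definition tree_ray (t : {nonneg R}) : T := CayleyTree (ray_coord_tree t).

Lemma tree_ray_nat (k : nat) (t : {nonneg R}) :
  t%:num = k%:R -> tree_ray t = vertex R X (ray_vertex k).
Proof.
move=> tk; apply: bary_inj; rewrite /= tk (@ray_coordE k) ?subrr ?segment_coord0//.
by rewrite lexx ler_nat leqnSn.
Qed.

(** The height grows at unit speed along the ray because reducedness makes
    the [k]-th vertex have length exactly [k]. *)
Lemma tree_height_ray (t : {nonneg R}) : tree_height (tree_ray t) = t%:num.
Proof.
set k := Num.truncn t%:num.
have kt : k%:R <= t%:num <= k.+1%:R.
  by have t0 : 0 <= t%:num by []; have /andP[-> /ltW->] := truncn_itv t0.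
have -> : tree_height (tree_ray t) =
  (1 - (t%:num - k%:R)) * tree_height (vertex R X (ray_vertex k)) +
  (t%:num - k%:R) * tree_height (vertex R X (ray_vertex k.+1)).
  have := ray_coordE kt; rewrite /segment_coord ray_vertexS.
  case: (L k) => i [] /= rE; rewrite !tree_height_vertex.
    by rewrite (@tree_height_edge _ _ _ _ _ (ray_vertex k) i (t%:num - k%:R)).
  rewrite (@tree_height_edge _ _ _ _ _ (ray_vertex k * (X i)^-1)%g i
    (1 - (t%:num - k%:R))).
    by rewrite /letter_val /= mulgVK; ring.
  rewrite /= rE; apply/funext => c.
  by rewrite /edge_coord /letter_val /= mulgVK; ring.
by rewrite !tree_height_vertex !word_length_ray_vertex -natr1; ring.
Qed.

Lemma mdist_ray_segment k (s t : {nonneg R}) :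
  k%:R <= s%:num <= k.+1%:R -> k%:R <= t%:num <= k.+1%:R ->
  mdist (tree_ray s) (tree_ray t) <= `|s%:num - t%:num|.
Proof.
move=> ks kt; have [a [i [f [fE f01 fn]]]] := segment_coordE k.
have -> : s%:num - t%:num = (s%:num - k%:R) - (t%:num - k%:R) by ring.
have in01 (u : R) : k%:R <= u <= k.+1%:R -> 0 <= f (u - k%:R) <= 1.
  by move=> /andP[ku uk]; apply: f01; rewrite subr_ge0 ku lerBlDl natr1.
rewrite -fn; apply: (@mdist_same_edge _ _ _ _ _ _ a i); rewrite ?in01//=.
  by rewrite (ray_coordE ks).
by rewrite (ray_coordE kt).
Qed.

Lemma mdist_ray_le (s t : {nonneg R}) : s%:num <= t%:num ->
  mdist (tree_ray s) (tree_ray t) <= t%:num - s%:num.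
Proof.
have [m] : exists m : nat, t%:num <= m%:R.
  by exists (Num.truncn t%:num).+1; rewrite ltW// truncnS_gt.
elim: m s t => [|m IH] s t tm st.
  have -> : s = t by apply/val_inj/eqP; rewrite /= eq_le st (le_trans tm (ge0 s)).
  by rewrite mdistxx subrr.
have [tm'|/ltW mt] := leP t%:num m%:R; first exact: IH.
have [sm|/ltW ms] := leP s%:num m%:R; last first.
  rewrite -[_ - s%:num]ger0_norm ?subr_ge0// distrC.
  by apply: (@mdist_ray_segment m); apply/andP; split => //; exact: le_trans tm.
apply: le_trans (metric_triangle _ (tree_ray m%:R%:nng) _) _.
rewrite (_ : t%:num - _ = m%:R - s%:num + (t%:num - m%:R)); last by ring.
apply: lerD; first exact: IH.
rewrite -[leRHS]ger0_norm ?subr_ge0// distrC.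
apply: (@mdist_ray_segment m); rewrite /= ?lexx ?ler_nat ?leqnSn ?mt//.
Qed.

(** The ray is traversed at unit speed, hence the upper bound; the height is
    1-Lipschitz and takes the value [t] at time [t], hence the lower bound. *)
Lemma tree_ray_geodesic s t :
  mdist (tree_ray s) (tree_ray t) = `|s%:num - t%:num|.
Proof.
apply/le_anti/andP; split; last first.
  by rewrite -{1}(tree_height_ray s) -{1}(tree_height_ray t) tree_height_lipschitz.
have [st|/ltW ts] := leP s%:num t%:num.
  by rewrite distrC ger0_norm ?subr_ge0// mdist_ray_le.
by rewrite metric_sym ger0_norm ?subr_ge0// mdist_ray_le.
Qed.

Lemma tree_ray_origin : tree_ray 0%:nng = vertex R X 1%g.
Proof. by rewrite (@tree_ray_nat 0)// /ray_vertex /word_val big_nil. Qed.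

Definition word_ray : geodesic_ray (vertex R X 1%g) :=
  GeodesicRay tree_ray_origin tree_ray_geodesic.

End Ray.

(** * Continuity on subspaces and compactness *)

Section Within.
Context {R : realType}.

Lemma within_comp (S T U : topologicalType) (D : set S) (E : set T)
    (f : S -> T) (g : T -> U) :
  {within D, continuous f} -> (forall x, D x -> E (f x)) ->
  {within E, continuous g} -> {within D, continuous (g \o f)}.
Proof.
move=> /subspace_continuousP cf fDE /subspace_continuousP cg.
apply/subspace_continuousP => x Dx W /(cg _ (fDE _ Dx)) gW.
have fW : \forall y \near x, D y -> E (f y) -> W (g (f y)) := cf _ Dx _ gW.
suff : \forall y \near x, D y -> W (g (f y)) by [].
by apply: filterS fW => y fy Dy; apply: fy => //; exact: fDE.
Qed.

Lemma within_closed_preimage (S T : topologicalType) (D : set S) (f : S -> T)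
    (C : set T) :
  closed D -> {within D, continuous f} -> closed C -> closed (D `&` f @^-1` C).
Proof.
by move=> cD /continuous_closedP cf cC; rewrite closed_setSI//; exact: cf.
Qed.

Lemma path_end_closed (Y : topologicalType) (c : R -> Y) (C : set Y) :
  {within `[0, 1], continuous c} -> closed C ->
  (forall s, 0 <= s < 1 -> C (c s)) -> C (c 1).
Proof.
move=> /subspace_continuousP cc cC Cc.
have c1 : c @ (1 : R)^'- --> c 1.
  have := cc 1; rewrite /= in_itv /= ler01 lexx => /(_ isT) c1 W c1W.
  have cW : \forall x \near (1 : R), x \in `[0, 1] -> W (c x) := c1 _ c1W.
  suff : \forall x \near (1 : R), x < 1 -> W (c x) by [].
  apply: filterS2 cW (lt_nbhsr ltr01) => x cx x0 x1.
  by apply: cx; rewrite in_itv /= !ltW.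
apply: (@closed_cvg _ _ _ _ c C cC _ _ c1).
suff : \forall x \near (1 : R), x < 1 -> C (c x) by [].
by apply: filterS (lt_nbhsr ltr01) => x x0 x1; apply: Cc; rewrite ltW.
Qed.

Lemma bigcup_finite_compact (T : topologicalType) (I : Type) (D : set I)
    (F : I -> set T) :
  finite_set D -> (forall i, D i -> compact (F i)) -> compact (\bigcup_(i in D) F i).
Proof.
elim/Pchoice: I => I in D F *.
move=> /finite_seqP[s ->] Fc; rewrite bigcup_seq big_seq.
by apply: bigsetU_compact => i; exact: Fc.
Qed.

(** Near-coverings are applied to the filter of finite subfamilies of [U]
    ordered by inclusion. *)
Lemma compact_open_cover (T : topologicalType) (A : set T) (U : set (set T)) :
  compact A -> (forall V, U V -> open V) -> A `<=` \bigcup_(V in U) V ->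
  exists2 U', finite_set U' /\ U' `<=` U & A `<=` \bigcup_(V in U') V.
Proof.
move=> /compact_near_coveringP cA oU AU.
pose fin W := finite_set W /\ W `<=` U.
pose F := filter_from fin (fun W => [set W' : set (set T) | W `<=` W' /\ fin W']).
have FF : Filter F.
  apply: filter_from_filter; first by exists set0; split.
  move=> W W' [fW WU] [fW' WU']; exists (W `|` W').
    by split; [rewrite finite_setU|move=> V []; [exact: WU|exact: WU']].
  move=> W1 [WW1 fW1].
  by split; split=> // V WV; apply: WW1; [left|right].
pose P (W : set (set T)) y := exists2 V, W V & V y.
have cover y : A y -> \forall y' \near y & W \near F, P W y'.
  move=> /AU[V UV Vy]; exists (V, [set W | [set V] `<=` W /\ fin W]).
    split; first by apply: open_nbhs_nbhs; split => //=; exact: oU.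
    by exists [set V] => //; split; [exact: finite_set1|move=> _ ->].
  by move=> [y' W] /= [Vy' [VW _]]; exists V => //; exact: VW.
have [W fW FW] := cA _ F P FF cover.
by exists W => //; apply: FW; split.
Qed.

End Within.

(** * Cells and finite subcomplexes *)

Section Disk.
Context {R : realType}.
Implicit Types (d : nat) (s : R).

Lemma scale_disk d (v : 'rV[R]_d) s : disk R d v -> 0 <= s <= 1 -> disk R d (s *: v).
Proof.
rewrite /disk /= => v1 /andP[s0 s1]; under eq_bigr do rewrite mxE exprMn.
rewrite -mulr_sumr; apply: mulr_ile1 => //; first exact: exprn_ge0.
  by apply: sumr_ge0 => i _; exact: sqr_ge0.
by rewrite exprn_ile1.
Qed.

Lemma scale_open_disk d (v : 'rV[R]_d) s :
  disk R d v -> 0 <= s < 1 -> open_disk R d (s *: v).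
Proof.
rewrite /disk /open_disk /= => v1 /andP[s0 s1].
under eq_bigr do rewrite mxE exprMn.
rewrite -mulr_sumr; apply: (@le_lt_trans _ _ (s ^+ 2)).
  by rewrite ler_piMr// sqr_ge0.
by rewrite exprn_ilt1.
Qed.

Lemma open_disk_sub d : open_disk R d `<=` disk R d.
Proof. by move=> v /ltW. Qed.

Lemma closed_disk d : closed (disk R d).
Proof.
apply: (@preimage_closed _ _ (fun v : 'rV[R]_d => \sum_i v ord0 i ^+ 2) [set x | x <= 1]);
  last exact: closed_le.
have sum_cont : continuous (fun v : 'rV[R]_d => \sum_i v ord0 i ^+ 2).
  apply: continuous_big => [|i _]; first exact: add_continuous.
  move=> v; exact: (continuous_comp (@coord_continuous _ _ _ _ _ _)
    (@exprn_continuous _ _ _)).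
by move=> v _; exact: sum_cont.
Qed.

Lemma compact_disk d : compact (disk R d).
Proof.
apply: bounded_closed_compact (@closed_disk d).
exists 1; split => // M M1 v v1; apply: le_trans (ltW M1).
rewrite [leLHS]/Num.Def.normr /= mx_normrE; apply: bigmax_le => // -[i j] _ /=.
rewrite (ord1 i) -(@expr_le1 _ 2)// real_normK ?num_real//.
apply: le_trans v1; rewrite (bigD1 j) //= lerDl.
by apply: sumr_ge0 => k _; exact: sqr_ge0.
Qed.

End Disk.

Section CellComplex.
Context {R : realType} (Y : topologicalType) (K : cw_structure R Y).
Implicit Types e : cell K.

Lemma open_cell_sub e : open_cell e `<=` closed_cell e.
Proof. exact/image_subset/open_disk_sub. Qed.

Lemma compact_closed_cell e : compact (closed_cell e).
Proof.
apply: continuous_compact; first exact: chi_continuous.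
exact: compact_disk.
Qed.

Lemma closed_closed_cell e : closed (closed_cell e).
Proof. by apply: compact_closed (cw_hausdorff K) _; exact: compact_closed_cell. Qed.

Lemma open_cell_inj e e' y : open_cell e y -> open_cell e' y -> e = e'.
Proof.
by move=> ey e'y; have [e0 [_ u]] := cell_partition K y; rewrite -(u e)// -(u e').
Qed.

Lemma open_cell_exists y : exists e, open_cell e y.
Proof. by have [e [ey _]] := cell_partition K y; exists e. Qed.

(** The radius of the disk through a preimage of the point. *)
Lemma radial_path e y : closed_cell e y -> exists c : R -> Y,
  [/\ {within `[0, 1], continuous c}, c 1 = y &
      forall s, 0 <= s < 1 -> open_cell e (c s)].
Proof.
move=> [v v1 <-]; exists (fun s => @chi _ _ K e (s *: v)); split.
- apply: (@within_comp _ _ _ _ (disk R (cell_dim e)) (fun s : R => s *: v)).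
  + by apply: continuous_subspaceT; exact: scalel_continuous.
  + by move=> s; rewrite /= in_itv /=; exact: scale_disk.
  + exact: chi_continuous.
- by rewrite scale1r.
- by move=> s s01; exists (s *: v) => //; exact: scale_open_disk.
Qed.

Lemma closed_cell_finite e : exists2 F : set (cell K),
  finite_set F & forall y, closed_cell e y -> exists2 f, F f & open_cell f y.
Proof.
have [F [fF _ sF]] := closure_finite e; exists (F `|` [set e]).
  by rewrite finite_setU; split=> //; exact: finite_set1.
move=> y [v]; rewrite /disk /= le_eqVlt => /predU1P[v1|v1] <-.
  by have [|f Ff fv] := sF (@chi _ _ K e v); [exists v|exists f => //; left].
by exists e; [right|exists v].
Qed.

Lemma subcomplex_bigcup (I : Type) (D : set I) (S : I -> set Y) :
  (forall i, D i -> subcomplex K (S i)) -> subcomplex K (\bigcup_(i in D) S i).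
Proof.
move=> Ssub e [y [ey [i Di Siy]]] z ez; exists i => //.
by apply: (Ssub i Di e) ez; exists y.
Qed.

(** By induction on the dimension: the boundary of a cell lies in finitely many
    cells of smaller dimension, whose hulls are adjoined to the closed cell. *)
Lemma closed_cell_hull e :
  exists S, [/\ compact S, subcomplex K S & closed_cell e `<=` S].
Proof.
move: {2}(cell_dim e).+1 (ltnSn (cell_dim e)) => m.
elim: m e => // m IH e em.
have [F [fF dF sF]] := closure_finite e.
have /choice[S SP] : forall f, exists S : set Y,
    F f -> [/\ compact S, subcomplex K S & closed_cell f `<=` S].
  move=> f; have [Ff|nFf] := pselect (F f); last by exists set0.
  have [|S SP] := IH f; last by exists S.
  exact: leq_trans (dF f Ff) _.
have SF : @chi _ _ K e @` sphere R (cell_dim e) `<=` \bigcup_(f in F) S f.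
  move=> y /sF[f Ff fy]; exists f => //.
  by have [_ _] := SP f Ff; apply; exact: open_cell_sub.
have subS : subcomplex K (\bigcup_(f in F) S f).
  by apply: subcomplex_bigcup => f /SP[].
exists (closed_cell e `|` \bigcup_(f in F) S f); split; last by move=> y; left.
  apply: compactU; first exact: compact_closed_cell.
  by apply: bigcup_finite_compact => // f /SP[].
move=> e' [y [e'y]] [[v v1 vy]|Sy]; last first.
  by move=> z e'z; right; apply: (subS e') e'z; exists y.
move: v1; rewrite /disk /= le_eqVlt => /predU1P[v1|v1].
  move=> z e'z; right; apply: (subS e') e'z; exists y; split => //.
  by apply: SF; exists v.
have -> : e' = e by apply: open_cell_inj e'y _; exists v.
by move=> z ez; left.
Qed.

End CellComplex.

(** * Cocompact subspaces of a G-complex *)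

Section EquivariantComplex.
Context {R : realType} (G : groupType) (Y : gcw_complex R G).
Local Notation K := (gcw_cells Y).
Local Notation act := (@gcw_act R G Y).
Implicit Types (g : G) (y : Y) (e : cell K).

Lemma actM g h y : act (g * h)%g y = act g (act h y).
Proof. by have [_ ->] := @gcw_act_action R G Y. Qed.

Lemma actK g : cancel (act g) (act g^-1%g).
Proof. by move=> y; rewrite -actM mulVg; case: (@gcw_act_action R G Y). Qed.

Lemma actVK g : cancel (act g^-1%g) (act g).
Proof. by move=> y; rewrite -actM mulgV; case: (@gcw_act_action R G Y). Qed.

(** The action is only assumed to permute the open cells; closed cells follow by
    taking the end points of radial paths. *)
Lemma act_closed_cell g e : exists e',
  (forall y, open_cell e y -> open_cell e' (act g y)) /\
  (forall y, closed_cell e y -> closed_cell e' (act g y)).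
Proof.
have [e' [_ ge]] := gcw_act_cell g e; exists e'.
have o y : open_cell e y -> open_cell e' (act g y).
  by move=> ey; rewrite -ge; exists y.
split=> // y /radial_path[c [cc c1 co]]; rewrite -c1.
apply: (@path_end_closed R _ (act g \o c)).
- apply: (@within_comp _ _ _ _ setT c (act g)) => //; apply: continuous_subspaceT.
  exact: gcw_act_continuous.
- exact: closed_closed_cell.
- by move=> s s01; apply/open_cell_sub/o/co.
Qed.

Lemma subcomplex_act g S : subcomplex K S -> subcomplex K (act g @` S).
Proof.
move=> subS e [y [ey [x Sx xy]]] z ez.
have [e' [eo ec]] := act_closed_cell g^-1%g e.
exists (act g^-1%g z); last exact: actVK.
apply: (subS e'); last exact: ec.
by exists x; split => //; have := eo _ ey; rewrite -xy actK.
Qed.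

Lemma open_cell_orbit_inj g e y :
  open_cell e y -> open_cell e (act g y) -> act g y = y.
Proof.
move=> ey egy; have [e' [_ ge]] := gcw_act_cell g e.
have ee' : e' = e by apply: open_cell_inj egy; rewrite -ge; exists y.
by apply: gcw_act_rigid ey; rewrite ge ee'.
Qed.

(** The orbit of the cell containing [y], as a set of cells: a name for this
    orbit that does not depend on a choice of representative. *)
Definition cell_orbit y : set (cell K) := [set e | exists g, open_cell e (act g y)].

Lemma cell_orbit_act g y : cell_orbit (act g y) = cell_orbit y.
Proof.
apply/seteqP; split => e [h eh].
  by exists (h * g)%g; rewrite actM.
by exists (h * g^-1)%g; rewrite actM actK.
Qed.

Lemma cell_orbit_open_cell e y z :
  open_cell e y -> open_cell e z -> cell_orbit y = cell_orbit z.
Proof.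
suff sub x x' : open_cell e x -> open_cell e x' -> cell_orbit x `<=` cell_orbit x'.
  by move=> ey ez; apply/seteqP; split; exact: sub.
move=> ex ex' f [g fg]; exists g; have [e' [_ ge]] := gcw_act_cell g e.
have <- : e' = f by apply: open_cell_inj fg; rewrite -ge; exists x.
by rewrite -ge; exists x'.
Qed.

Definition translates (S : set Y) : set Y := [set y | exists g, S (act g y)].

(** By rigidity an open cell contains at most one point of such a set, so a closed
    cell contains only finitely many, and the weak topology applies. *)
Lemma closed_sparse (Z : set Y) :
  (forall y z, Z y -> Z z -> cell_orbit y = cell_orbit z -> exists g, z = act g y) ->
  closed Z.
Proof.
move=> Zsparse; apply/(cw_weak K) => e.
have [F fF Fcover] := closed_cell_finite e.
have -> : disk R (cell_dim e) `&` @chi _ _ K e @^-1` Z =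
    disk R (cell_dim e) `&` @chi _ _ K e @^-1` (\bigcup_(f in F) (open_cell f `&` Z)).
  apply/seteqP; split => v [v1 /=]; last by case=> f _ [].
  move=> Zv; split=> //; have [|f Ff fv] := Fcover (@chi _ _ K e v); first by exists v.
  by exists f.
apply: within_closed_preimage (@closed_disk _ _) (@chi_continuous _ _ K e) _.
apply: (accessible_finite_set_closed.1 (hausdorff_accessible (cw_hausdorff K))).
apply: bigcup_finite => // f Ff.
have [->|/set0P[y [fy Zy]]] := eqVneq (open_cell f `&` Z) set0.
  exact: finite_set0.
suff -> : open_cell f `&` Z = [set y] by exact: finite_set1.
apply/seteqP; split => [z [fz Zz]|z -> //].
have [g zE] := Zsparse _ _ Zy Zz (cell_orbit_open_cell fy fz).
by rewrite zE; apply: open_cell_orbit_inj fy _; rewrite -zE.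
Qed.

(** One point is chosen in each orbit of cells that the subspace meets. Removing
    the orbits of all chosen points but one leaves an open set, and these sets
    cover; each chosen point lies in only one of them, so a finite subcover
    bounds the number of orbits of cells. *)
Lemma cocompact_finite_cells (L : set Y) : cocompact_subspace L ->
  exists2 F : set (cell K), finite_set F &
    forall y, L y -> exists g e, F e /\ open_cell e (act g y).
Proof.
move=> [Linv Lcov].
have [->|/set0P[y0 Ly0]] := eqVneq L set0; first by exists set0.
pose I := cell_orbit @` L.
have /choice[r rP] : forall k, exists y, I k -> L y /\ cell_orbit y = k.
  by move=> k; have [[y Ly yk]|nI] := pselect (I k); [exists y|exists y0].
pose Z k := [set y | exists k' g, [/\ I k', k' <> k & y = act g (r k')]].
have cZ k : closed (Z k).
  apply: closed_sparse => _ _ [k1 [g1 [I1 _ ->]]] [k2 [g2 [I2 _ ->]]].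
  rewrite !cell_orbit_act (rP _ I1).2 (rP _ I2).2 => ->.
  by exists (g2 * g1^-1)%g; rewrite actM actK.
pose U := [set V | exists2 k, I k & V = ~` Z k].
have [||U' [fU' U'U] LU'] := Lcov U.
- move=> _ [k _ ->]; split; first exact: closed_openC.
  move=> g y nZ [k' [h [Ik' k'k yE]]]; apply: nZ; exists k', (g^-1 * h)%g.
  by split=> //; rewrite actM -yE actK.
- move=> y Ly; exists (~` Z (cell_orbit y)).
    by exists (cell_orbit y) => //; exists y.
  move=> [k' [h [Ik' k'k yE]]]; apply: k'k.
  by rewrite yE cell_orbit_act (rP _ Ik').2.
have /choice[k kP] : forall V, exists k, U' V -> I k /\ V = ~` Z k.
  move=> V; have [/U'U[k Ik VE]|nV] := pselect (U' V); first by exists k.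
  by exists set0.
have [e0 _] := open_cell_exists K y0.
have /choice[p pP] : forall k, exists e, I k -> k e.
  move=> k'; have [[y _ <-]|nI] := pselect (I k'); last by exists e0.
  have [e ey] := open_cell_exists K (act 1%g y).
  by exists e => _; exists 1%g.
exists ((p \o k) @` U'); first exact: finite_image.
move=> y Ly; have Iy : I (cell_orbit y) by exists y.
have [Lr ry] := rP _ Iy; have [V U'V Vr] := LU' _ Lr.
have [IkV VE] := kP V U'V.
have kV : k V = cell_orbit y.
  apply: contrapT => kVy; move: Vr; rewrite VE; apply; exists (cell_orbit y), 1%g.
  split=> //; first by move=> /esym.
  by have [->] := @gcw_act_action R G Y.
have [g gy] := pP _ Iy; exists g, (p (cell_orbit y)); split=> //.
by exists V => //=; rewrite kV.
Qed.

Lemma cocompact_sub_translates (L : set Y) : cocompact_subspace L ->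
  exists S, [/\ compact S, subcomplex K S & L `<=` translates S].
Proof.
move=> /cocompact_finite_cells[F fF LF].
have /choice[S SP] := @closed_cell_hull R Y K.
exists (\bigcup_(e in F) S e); split.
- by apply: bigcup_finite_compact => // e _; have [] := SP e.
- by apply: subcomplex_bigcup => e _; have [] := SP e.
- move=> y /LF[g [e [Fe egy]]]; exists g, e => //.
  by have [_ _] := SP e; apply; exact: open_cell_sub.
Qed.

Lemma sub_translates S : S `<=` translates S.
Proof. by move=> y Sy; exists 1%g; have [->] := @gcw_act_action R G Y. Qed.

Lemma translates_cocompact S : compact S -> cocompact_subspace (translates S).
Proof.
move=> cS; split=> [g y [h Shy]|U UP SU].
  by exists (h * g^-1)%g; rewrite actM actK.
have [V /UP[]//||U' [fU' U'U] SU'] := compact_open_cover (U := U) cS.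
- exact: subset_trans (@sub_translates S) SU.
exists U' => // y [g Sgy]; have [V U'V Vgy] := SU' _ Sgy; exists V => //.
by have [_ Vinv] := UP V (U'U V U'V); rewrite -(actK g y); exact: Vinv.
Qed.

End EquivariantComplex.

(** * Paths *)

Section Paths.
Context {R : realType} (Y : topologicalType).
Implicit Types (S : set Y) (y z : Y).

Lemma connected_by_path_sym S y z :
  connected_by_path R S y z -> connected_by_path R S z y.
Proof.
move=> [c [cc c0 c1 Sc]]; exists (c \o (fun s => 1 - s)); split.
- apply: (@within_comp R R Y `[0, 1] `[0, 1] (fun s => 1 - s) c) => //.
    by apply: continuous_subspaceT => s; apply: cvgB; [exact: cvg_cst|exact: cvg_id].
  by move=> s /=; rewrite !in_itv /= => s01; lra.
- by rewrite /= subr0.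
- by rewrite /= subrr.
- by move=> s s01; apply: Sc; lra.
Qed.

Lemma connected_by_path_trans S x y z :
  connected_by_path R S x y -> connected_by_path R S y z ->
  connected_by_path R S x z.
Proof.
move=> [c [cc c0 c1 Sc]] [d [cd d0 d1 Sd]].
exists (fun s => if s <= 2^-1 then c (2 * s) else d (2 * s - 1)); split.
- have -> : `[0, 1]%classic = `[0, 2^-1]%classic `|` `[2^-1, 1]%classic :> set R.
    apply/seteqP; split => s /=; rewrite !in_itv /=; last by case; lra.
    by move=> s01; have [sh|sh] := leP s 2^-1; [left|right]; lra.
  apply: withinU_continuous; [exact: interval_closed|exact: interval_closed| |].
    apply: (@subspace_eq_continuous _ _ _ (c \o (fun s => 2 * s))).
      by move=> s; rewrite inE /= in_itv /= => /andP[_ sh]; rewrite /from_subspace /= sh.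
    apply: (@within_comp R R Y _ `[0, 1] (fun s => 2 * s) c) => //.
      by apply: continuous_subspaceT; exact: mulrl_continuous.
    by move=> s /=; rewrite !in_itv /= => s01; lra.
  apply: (@subspace_eq_continuous _ _ _ (d \o (fun s => 2 * s - 1))).
    move=> s; rewrite inE /= in_itv /= => /andP[sh _]; rewrite /from_subspace /=.
    have [s2|//] := leP s 2^-1; have -> : s = 2^-1 by lra.
    by rewrite divff// subrr c1 d0.
  apply: (@within_comp R R Y _ `[0, 1] (fun s => 2 * s - 1) d) => //.
    apply: continuous_subspaceT => s; apply: cvgB; last exact: cvg_cst.
    exact: mulrl_continuous.
  by move=> s /=; rewrite !in_itv /= => s01; lra.
- by rewrite invr_ge0 ler0n mulr0.
- have -> : (1 <= 2^-1 :> R) = false by apply/negbTE; rewrite -ltNge; lra.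
  by have -> : 2 * 1 - 1 = 1 :> R by ring.
- by move=> s s01; case: ifPn => [|/negbTE] sh; [apply: Sc|apply: Sd]; move: sh; lra.
Qed.

End Paths.

(** * Horoballs *)

Section Horoballs.
Context {R : realType} (M : metricType R) (o : M) (tau : geodesic_ray o).

Lemma horoball_near t D p q :
  horoball tau (t + D) p -> mdist p q <= D -> horoball tau t q.
Proof.
have [D0|D0] := ltP D 0; first by have := mdist_ge0 p q; lra.
move=> [l /= tl pl] pq; exists l => /=; first by move: tl; lra.
by have := metric_triangle (tau l) p q; move: pl pq; lra.
Qed.

(** The balls defining a horoball increase along the ray, so one may pass to
    centres as far along it as desired. *)
Lemma horoball_far t p : horoball tau t p ->
  exists m0, forall l : {nonneg R}, m0 <= l%:num -> mdist (tau l) p <= l%:num - t.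
Proof.
move=> [l0 /= _ pl]; exists l0%:num => l l0l.
have := metric_triangle (tau l) (tau l0) p; rewrite ray_geodesic ger0_norm ?subr_ge0//.
by move: pl; lra.
Qed.

Lemma horoball_ball t (l : {nonneg R}) p :
  mdist (tau l) p <= l%:num - t -> horoball tau t p.
Proof. by move=> pl; exists l => //=; have := mdist_ge0 (tau l) p; lra. Qed.

End Horoballs.

(** * From chains in the group to controlled connectedness *)

Section Criterion.
Context {R : realType} (G : groupType) (M : metricType R).
Variables (rho : isometric_action G M) (o : M) (tau : geodesic_ray o).
Variable gens : seq G.

(** Only the starting point of a step is required to lie over the horoball: the
    end point is at bounded distance from it, and that bound is absorbed in the
    loss of the criterion. *)
Definition horoball_step t (g g' : G) : Prop :=
  horoball tau t (rho g o) /\ exists2 s, s \in gens & g' = (g * s)%g.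

Hypothesis horoball_chains : forall t g g',
  horoball tau t (rho g o) -> horoball tau t (rho g' o) ->
  clos_refl_sym_trans G (horoball_step t) g g'.

Variables (Y : gcw_complex R G) (h : Y -> M).
Hypotheses (ch : continuous h) (eh : equivariant rho h).
Local Notation act := (@gcw_act R G Y).

Lemma bounded_on_compact (C : set Y) : compact C ->
  exists2 D, 0 <= D & forall y, C y -> mdist o (h y) <= D.
Proof.
move=> cC; pose f y : R^o := mdist o (h y).
have cf : continuous f.
  move=> y; apply/cvgrPdist_lt => e e0.
  have hy : \forall z \near y, ball (h y) e (h z) := @ch y _ (nbhsx_ballx _ _ e0).
  near=> z; have : ball (h y) e (h z) by near: z.
  rewrite ballEmdist /= => hz.
  rewrite /f; have := metric_triangle o (h y) (h z).
  have := metric_triangle o (h z) (h y); rewrite [mdist (h z) _]metric_sym.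
  by move=> h1 h2; rewrite ltr_norml; apply/andP; split; lra.
have := @compact_bounded _ _ _ (continuous_compact (continuous_subspaceT cf) cC).
move=> [B [Breal fB]]; exists (`|B| + 1); first by rewrite addr_ge0.
move=> y Cy; apply: le_trans (ler_norm _) _.
apply: (fB (`|B| + 1)); last by exists y.
by rewrite (le_lt_trans (ler_norm B))// ltrDl.
Unshelve. all: by end_near. Qed.

Lemma mdist_act g y : mdist (rho g o) (h (act g y)) = mdist o (h y).
Proof. by rewrite eh iact_isom. Qed.

(** A subcomplex of bounded image, translated to lie deep over a horoball, is one
    of the subcomplexes whose union is the subcomplex over the horoball. *)
Lemma translate_sub_horoball_subcomplex t (S : set Y) g D :
  subcomplex (gcw_cells Y) S -> (forall y, S y -> mdist o (h y) <= D) ->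
  horoball tau (t + D) (rho g o) -> act g @` S `<=` horoball_subcomplex h tau t.
Proof.
move=> subS SD go y gSy; exists (act g @` S) => //; split; first exact: subcomplex_act.
move=> _ [x Sx <-] /=; apply: horoball_near go _.
by rewrite mdist_act SD.
Qed.

(** Both clauses of controlled connectedness follow from the second one, since
    the loss obtained here is the same for all horoballs. *)
Lemma controlled_connected_of_chains : contractible R Y ->
  controlled_connected h tau.
Proof.
move=> [y0 [H [cH H0 H1]]] L cL.
have [S0 [cS0 _ LS0]] := cocompact_sub_translates cL.
pose S1 := S0 `|` (fun s => act s y0) @` [set` gens].
have cS1 : compact S1.
  apply: compactU => //; apply: finite_compact; apply: finite_image.
  exact: finite_seq.
(* [C] is the trace of the contraction, restricted to [S1]. *)
pose C := H @` (S1 `*` `[0, 1]).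
have cC : compact C.
  apply: continuous_compact; last exact/compact_setX/segment_compact.
  by apply: continuous_subspaceW cH => -[y s] [_ s01]; split.
have [S2 [cS2 subS2 CS2]] := cocompact_sub_translates (translates_cocompact cC).
have S1C y : S1 y -> C y.
  by move=> Sy; exists (y, 0); [split=> //=; rewrite in_itv /= lexx ler01|exact: H0].
have [D1 D1_ge0 CD1] := bounded_on_compact cC.
have [D2 D2_ge0 S2D2] := bounded_on_compact cS2.
exists (translates S2); split; first exact: translates_cocompact.
  move=> y /LS0[g S0y]; apply: CS2; exists g; apply: S1C; by left.
(* The image of a point of [g C] is within [D1] of [g o], and the image of the
   translate of [S2] containing this point has diameter at most [D2 + D2]. *)
pose E := D1 + (D2 + D2).
(* The contraction, translated by [g], joins [g u] to [g y0]. *)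
have contract t g u : S1 u -> horoball tau (t + E) (rho g o) ->
    connected_by_path R (horoball_subcomplex h tau t `&` translates S2)
      (act g u) (act g y0).
  move=> S1u go; exists (act g \o (H \o (fun s => (u, s)))); split.
  - apply: (@within_comp _ _ _ _ setT (H \o (fun s => (u, s))) (act g)) => //; last first.
      by apply: continuous_subspaceT; exact: gcw_act_continuous.
    apply: (@within_comp R (Y * R)%type Y _ (setT `*` `[0, 1]) (fun s => (u, s)) H)
      => //.
    apply: continuous_subspaceT => s.
    apply: (@cvg_pair _ _ _ (nbhs s) (nbhs u) (nbhs s)) => //; exact: cvg_cst.
  - by rewrite /= H0.
  - by rewrite /= H1.
  - move=> s s01 /=; set p := act g _.
    have Cp : C (H (u, s)) by exists (u, s) => //; split=> //=; rewrite in_itv.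
    have tp : translates S2 p.
      by apply: CS2; exists g^-1%g; rewrite actK.
    split=> //; have [g' S2p] := tp.
    apply: (@translate_sub_horoball_subcomplex t S2 g'^-1%g D2) => //; last first.
      by exists (act g' p) => //; rewrite actK.
    have hp : horoball tau (t + (D2 + D2)) (h p).
      apply: (@horoball_near _ _ _ tau _ D1 (rho g o)).
        by rewrite (_ : _ + _ + D1 = t + E)// /E; ring.
      by rewrite mdist_act CD1.
    apply: (@horoball_near _ _ _ tau _ D2 (h p)); first by rewrite -addrA.
    rewrite metric_sym -(actK g' p) mdist_act; exact: S2D2.
have chain t g g' : clos_refl_sym_trans G (horoball_step (t + E)) g g' ->
    g = g' \/ connected_by_path R (horoball_subcomplex h tau t `&` translates S2)
      (act g y0) (act g' y0).
  elim=> [{}g {}g' [go [s sg ->]]|{}g|{}g {}g' _|g1 g2 g3 _ + _].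
  - right; apply: connected_by_path_sym; rewrite actM; apply: contract => //.
    by right; exists s.
  - by left.
  - by case=> [->|/connected_by_path_sym]; [left|right].
  - case=> [-> //|p12] [<-|p23]; first by right.
    by right; exact: connected_by_path_trans p12 p23.
(* Another [D1] is lost between the image of a point of [L], which lies in some
   [g C], and [g o]. *)
pose lam := E + D1.
have conn t y z : (horoball_subcomplex h tau (t + lam) `&` L) y ->
    (horoball_subcomplex h tau (t + lam) `&` L) z ->
    connected_by_path R (horoball_subcomplex h tau t `&` translates S2) y z.
  have over x : (horoball_subcomplex h tau (t + lam) `&` L) x -> exists g u,
      [/\ x = act g u, S1 u & horoball tau (t + E) (rho g o)].
    move=> [[S' [_ S'h] S'x] Lx]; have [g S0x] := LS0 _ Lx.
    have S1x : S1 (act g x) by left.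
    exists g^-1%g, (act g x); split => //; first by rewrite actK.
    apply: (@horoball_near _ _ _ tau _ D1 (h x)).
      by rewrite -addrA; exact: S'h.
    rewrite metric_sym -{1}(actK g x) mdist_act; exact/CD1/S1C.
  move=> /over[g [u [-> S1u go]]] /over[g' [u' [-> S1u' go']]].
  have gy0 := contract t g u S1u go.
  have g'y0 := connected_by_path_sym (contract t g' u' S1u' go').
  apply: connected_by_path_trans gy0 _.
  have [->|gg'] := chain t g g' (horoball_chains go go'); first exact: g'y0.
  exact: connected_by_path_trans gg' g'y0.
move=> t; exists lam; split; first by rewrite /lam /E !addr_ge0.
  by move=> y z yL zL; apply: conn; rewrite subrK.
exact: conn.
Qed.

End Criterion.

(** * The commutator ray *)

Section Multiplicative.
Variables (A H : groupType) (phi : {multiplicative A -> H}).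

Lemma multiplicative1 : phi 1%g = 1%g.
Proof. by apply: (mulgI (phi 1%g)); rewrite -gmulfM !mulg1. Qed.

Lemma multiplicativeV a : phi a^-1%g = (phi a)^-1%g.
Proof. by apply: (mulgI (phi a)); rewrite -gmulfM !mulgV multiplicative1. Qed.

End Multiplicative.

Section CommutatorRay.
Variables (n : nat) (i j : 'I_n).

Definition commutator_letter k : 'I_n * bool :=
  (if odd k then j else i, (k %% 4 < 2)%N).

Lemma commutator_letter_reduced k : i != j ->
  commutator_letter k.+1 != ((commutator_letter k).1, ~~ (commutator_letter k).2).
Proof.
move=> ij; rewrite /commutator_letter /= xpair_eqE negb_and; apply/orP; left.
by case: (odd k) => //=; rewrite eq_sym.
Qed.

Lemma ray_vertex_commutator (A : groupType) (X : free_basis A n) k :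
  ray_vertex X commutator_letter (4 * k.+1) =
  (ray_vertex X commutator_letter (4 * k) * (X i * X j * (X i)^-1 * (X j)^-1))%g.
Proof.
have letter_mod m : commutator_letter (4 * k + m) = commutator_letter m.
  by rewrite /commutator_letter oddD oddM /= mulnC modnMDl.
have step m : ray_vertex X commutator_letter (4 * k + m.+1) =
    (ray_vertex X commutator_letter (4 * k + m) * letter_val X (commutator_letter m))%g.
  by rewrite addnS ray_vertexS letter_mod.
by rewrite mulnS addnC !step addn0 !mulgA.
Qed.

Lemma phi_commutator_ray (A H : groupType) (X : free_basis A n)
    (phi : {multiplicative A -> H}) k :
  (forall a a' : A, commute (phi a) (phi a')) ->
  phi (ray_vertex X commutator_letter (4 * k)) = 1%g.
Proof.
move=> phiC; elim: k => [|k IH].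
  by rewrite muln0 /ray_vertex /word_val big_nil multiplicative1.
rewrite ray_vertex_commutator gmulfM IH mul1g !gmulfM !multiplicativeV.
by rewrite (phiC (X i) (X j)) mulgK mulgV.
Qed.

End CommutatorRay.

(** * Chains in the semidirect product *)

Section SemidirectChains.
Variables (R : realType) (n : nat) (A : groupType) (X : free_basis A n).
Variables (B : groupType) (phi : {multiplicative A -> Autom B}).
Variables (L : nat -> 'I_n * bool).
Hypothesis L_reduced : forall k, L k.+1 != ((L k).1, ~~ (L k).2).
Variable s : seq (semidirect phi).
Hypothesis s_gen : forall H : {pred semidirect phi},
  group_closed H -> {subset s <= H} -> forall g, g \in H.
Hypothesis L_ker : forall m : nat,
  exists2 k, (m <= k)%N & phi (ray_vertex X L k) = 1%g.

Let o := vertex R X 1%g.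
Let tau := word_ray R X L_reduced.
Let rho := induced_action R X phi.
Local Notation v := (ray_vertex X L).
Local Notation el b a := ((b, a) : semidirect phi).

Definition semidirect_gens : seq (semidirect phi) :=
  [seq el g.1 1%g | g <- s] ++ [seq el 1%g (X i) | i <- enum 'I_n].

Variable t : R.
Local Notation HB a := (horoball tau t (vertex R X a)).
Local Notation "g ~~> g'" :=
  (clos_refl_sym_trans _ (horoball_step rho tau semidirect_gens t) g g')
  (at level 70).

Lemma rho_vertex g : rho g o = vertex R X g.2.
Proof. by rewrite /= tree_act_vertex mulg1. Qed.

Lemma semidirect_mulE b a b' a' :
  (el b a * el b' a')%g = el (b * phi a b')%g (a * a')%g.
Proof. by []. Qed.

Lemma Autom_1 (f : Autom B) : f 1%g = 1%g.
Proof. by apply: (mulgI (f 1%g)); rewrite -autM !mulg1. Qed.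

Lemma Autom_V (f : Autom B) b : f b^-1%g = (f b)^-1%g.
Proof. by apply: (mulgI (f b)); rewrite -autM !mulgV Autom_1. Qed.

Lemma chain_gen b a g : HB a -> g \in s -> el b a ~~> el (b * phi a g.1)%g a.
Proof.
move=> aHB gs; apply: rst_step; split; first by rewrite rho_vertex.
exists (el g.1 1%g); last by rewrite semidirect_mulE mulg1.
by rewrite mem_cat; apply/orP; left; apply/mapP; exists g.
Qed.

Lemma chain_letter b a l : HB a -> HB (a * letter_val X l)%g ->
  el b a ~~> el b (a * letter_val X l)%g.
Proof.
have edge c i : HB c -> el b c ~~> el b (c * X i)%g.
  move=> cHB; apply: rst_step; split; first by rewrite rho_vertex.
  exists (el 1%g (X i)); last by rewrite semidirect_mulE Autom_1 mulg1.
  by rewrite mem_cat; apply/orP; right; apply: map_f; rewrite mem_enum.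
case: l => i [] aHB alHB; first exact: edge.
by apply: rst_sym; rewrite -{2}[a](mulgVK (X i)); exact: edge.
Qed.

Let time (m : nat) : {nonneg R} := m%:R%:nng.

Lemma ray_nat m : tau (time m) = vertex R X (v m).
Proof. exact: tree_ray_nat. Qed.

Lemma HB_word m w : (size w)%:R <= m%:R - t -> HB (v m * word_val X w)%g.
Proof.
move=> wm; apply: (@horoball_ball _ _ _ tau t (time m)).
by rewrite ray_nat; apply: le_trans wm; exact: mdist_word.
Qed.

Lemma chain_word b m w : (size w)%:R <= m%:R - t ->
  el b (v m) ~~> el b (v m * word_val X w)%g.
Proof.
elim/last_ind: w => [|w l IH] wm.
  by rewrite /word_val big_nil mulg1; exact: rst_refl.
have wm' : (size w)%:R <= m%:R - t.
  by apply: le_trans wm; rewrite size_rcons ler_nat.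
apply: rst_trans (IH wm') _; rewrite word_val_rcons mulgA; apply: chain_letter.
  exact: HB_word.
by rewrite -mulgA -word_val_rcons; exact: HB_word.
Qed.

(** Two vertices of a horoball lie in a common ball of it centred on the ray;
    each is joined to the centre by the reduced word between them, whose prefixes
    stay in the ball. *)
Lemma chain_horoball b a a' : HB a -> HB a' -> el b a ~~> el b a'.
Proof.
move=> /horoball_far[l0 al0] /horoball_far[l1 al1].
have [m] : exists m : nat, Num.max l0 l1 <= m%:R.
  by exists (Num.truncn (Num.max l0 l1)).+1; apply/ltW/truncnS_gt.
rewrite ge_max => /andP[l0m l1m].
suff to c : mdist (tau (time m)) (vertex R X c) <= m%:R - t ->
    el b (v m) ~~> el b c.
  by apply: (rst_trans _ _ _ (el b (v m))); [apply: rst_sym|];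
    apply: to; [exact: al0|exact: al1].
rewrite ray_nat => cm.
have [_ cE] := reduced_wordP X ((v m)^-1 * c)%g.
rewrite -[c in X in _ ~~> X](mulVKg (v m)) -cE; apply: chain_word.
by apply: le_trans cm; exact: word_length_le_mdist.
Qed.

(** Left translation of [c] by a vertex of the ray killed by [phi], taken at
    least [t] plus the length of [c] along the ray. *)
Lemma horoball_lift c : exists2 c', HB c' & phi c' = phi c.
Proof.
have [w [[_ wc] _]] := free_basisP X c.
have [k mk vk] := L_ker (Num.truncn (t + (size w)%:R)).+1.
exists (v k * c)%g; last by rewrite gmulfM vk mul1g.
rewrite -wc; apply: HB_word; rewrite lerBrDl; apply: le_trans (ltW (truncnS_gt _)) _.
by rewrite ler_nat.
Qed.

(** The elements whose [B]-component, acted on by any [phi c], is reached by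
    chains form a subgroup. It contains the generators, because [c] can be
    replaced by a vertex of the horoball with the same action: one moves there,
    applies the generator and comes back. *)
Lemma chain_fibre b a b' : HB a -> el b a ~~> el (b * b')%g a.
Proof.
move=> aHB.
pose H : {pred semidirect phi} := fun g : semidirect phi =>
  `[< forall c b0, el b0 a ~~> el (b0 * phi c g.1)%g a >].
have HP g : reflect (forall c b0, el b0 a ~~> el (b0 * phi c g.1)%g a) (g \in H).
  exact: asboolP.
suff /HP/(_ 1%g b) : el b' 1%g \in H by rewrite multiplicative1.
apply: s_gen.
  split; first by apply/HP => c b0; rewrite Autom_1 mulg1; exact: rst_refl.
  move=> [b1 a1] [b2 a2] /HP /= H1 /HP /= H2; apply/HP => c b0.
  have -> : ((el b1 a1 / el b2 a2)%g).1 = (b1 * (phi (a1 * a2^-1)%g b2)^-1)%g.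
    by rewrite /= gmulfM /= !Autom_V.
  rewrite autM Autom_V mulgA; apply: rst_trans (H1 c b0) _.
  (* Dividing by the second component: its chain is read backwards. *)
  apply: rst_sym.
  have cE : phi (c * (a1 * a2^-1))%g b2 = phi c (phi (a1 * a2^-1)%g b2).
    by rewrite [phi (c * _)%g]gmulfM.
  have := H2 (c * (a1 * a2^-1))%g
    (b0 * phi c b1 * (phi c (phi (a1 * a2^-1)%g b2))^-1)%g.
  by rewrite cE mulgVK.
move=> g gs; apply/HP => c b0; have [c' c'HB <-] := horoball_lift c.
apply: rst_trans (chain_horoball b0 aHB c'HB) _.
apply: rst_trans (chain_gen b0 c'HB gs) _.
exact: chain_horoball.
Qed.

Lemma semidirect_horoball_chains (g g' : semidirect phi) :
  horoball tau t (rho g o) -> horoball tau t (rho g' o) -> g ~~> g'.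
Proof.
case: g g' => [b a] [b' a']; rewrite !rho_vertex /= => aHB a'HB.
apply: rst_trans (chain_horoball b aHB a'HB) _.
by rewrite -[b'](mulVKg b); exact: chain_fibre.
Qed.

End SemidirectChains.

Theorem corollary3 (R : realType) (n : nat) (A : groupType) (X : free_basis A n)
    (B : groupType) (phi : {multiplicative A -> Autom B}) :
  finitely_generated (semidirect phi) ->
  (forall a a' : A, commute (phi a) (phi a')) ->
  (2 <= n)%N ->
  Sigma1 (induced_action R X phi) (vertex R X 1%g) !=set0.
Proof.
move=> [s s_gen] phiC n2.
pose i := Ordinal (ltn_trans (ltnSn 0) n2); pose j := Ordinal n2.
have L_reduced k := @commutator_letter_reduced n i j k isT.
exists (word_ray R X L_reduced) => Y h _ cY ch eh.
apply: (controlled_connected_of_chains (gens := semidirect_gens X s)) ch eh cY.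
move=> t g g'; apply: semidirect_horoball_chains => // m.
by exists (4 * m)%N; [rewrite leq_pmull|exact: phi_commutator_ray].
Qed.
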